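(* Let $\phi>1$ be an integer. For arbitrarily large integers $n$ there exist (families of) feasible $n$-node graphs with election index $\phi$ such that leader election in time $\phi$ in these graphs requires advice of size $\Omega\!\left(n(\log\log n)^2/\log n\right)$. Precisely: there is a constant $c>0$ such that for infinitely many integers $n$ there is a finite family $\mathcal{F}_n$ of feasible $n$-node graphs, each with election index $\phi$, such that for every deterministic leader election algorithm with advice that performs leader election in time $\phi$ in every graph of $\mathcal{F}_n$, some graph of $\mathcal{F}_n$ receives advice of length at least $c\, n(\log\log n)^2/\log n$.
   Context: A graph is a simple undirected connected finite graph whose nodes have no identifiers; at each node $v$ of degree $d$ the incident edges carry distinct port numbers $0,\dots,d-1$ (local to each node). The truncated view $\mathcal{V}^0(v)$ is a single node; $\mathcal{V}^{l+1}(v)$ is the port-labelled rooted tree whose root has, for every neighbour $v_i$ of $v$, a child $x_i$ joined by an edge carrying the same two port numbers as $\{v,v_i\}$ (the one at $v$ at the root side), and $x_i$ is the root of a copy of $\mathcal{V}^l(v_i)$. The augmented truncated view $\mathcal{B}^l(v)$ is $\mathcal{V}^l(v)$ with each leaf labelled by the degree in $G$ of the node it represents. A graph is feasible if for some $l$ the views $\mathcal{B}^l(v)$ of all nodes are pairwise distinct; its election index is the smallest such $l$. Model (LOCAL): synchronous rounds, all nodes start simultaneously, in each round every node exchanges arbitrary messages with all neighbours and computes arbitrarily. Leader election: every node $v$ outputs a sequence $(p_1,q_1,\dots,p_k,q_k)$ of nonnegative integers describing a simple path starting at $v$ whose $i$-th edge has port $p_i$ at its endpoint closer to $v$ and $q_i$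 at the other endpoint; all these paths must end at a common node. Time is the number of rounds until all nodes output. Advice: an oracle knowing the entire port-labelled graph gives the same binary string to all nodes before the start; its length is the size of advice. In a deterministic algorithm with advice, the actions/output of node $v$ in round $r$ are a function of the advice and of $\mathcal{B}^r(v)$. Logarithms are base 2. *)

(* Defs.v *)
From mathcomp Require Import all_boot.
From Stdlib Require Import Reals.
Set Implicit Arguments. Unset Strict Implicit. Unset Printing Implicit Defensive.

(* A port-labelled graph on the n (anonymous) nodes 'I_n: [adj G v] lists, in
   port order, the pairs (neighbour w, port at w) for the edges incident to v;
   the position in the list is the port number at v. *)
Record pgraph (n : nat) := PGraph { adj : 'I_n -> seq ('I_n * nat) }.

Definition deg n (G : pgraph n) (v : 'I_n) : nat := size (adj G v).
Definition nbr n (G : pgraph n) (v : 'I_n) (p : nat) : 'I_n * nat :=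
  nth (v, 0) (adj G v) p.

Definition valid_graph n (G : pgraph n) : Prop :=
  (forall v p, p < deg G v ->
     let: (w, q) := nbr G v p in
     [/\ w != v, q < deg G w & nbr G w q = (v, p)]) /\
  (forall v, uniq (map fst (adj G v))) /\
  (forall v w, connect [rel x y | y \in map fst (adj G x)] v w).

(* Port-labelled rooted trees: augmented truncated views.  A leaf carries the
   degree of the node it represents; an internal node has one child per port
   p at the root, listed in port order, the edge carrying (p, q). *)
Inductive view : Type :=
| VLeaf of nat
| VNode of seq (nat * nat * view).

Fixpoint bview n (G : pgraph n) (l : nat) (v : 'I_n) : view :=
  match l with
  | 0 => VLeaf (deg G v)
  | l'.+1 => VNode [seq (p, (nbr G v p).2, bview G l' (nbr G v p).1)
                   | p <- iota 0 (deg G v)]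
  end.

Definition feasible n (G : pgraph n) : Prop :=
  exists l, injective (bview G l).

Definition election_index n (G : pgraph n) (phi : nat) : Prop :=
  injective (bview G phi) /\ (forall l, l < phi -> ~ injective (bview G l)).

Fixpoint walk n (G : pgraph n) (v : 'I_n) (s : seq nat) : option (seq 'I_n) :=
  match s with
  | [::] => Some [:: v]
  | p :: q :: s' =>
      if (p < deg G v) && ((nbr G v p).2 == q)
      then omap (cons v) (walk G (nbr G v p).1 s')
      else None
  | _ => None
  end.

Definition describes_path n (G : pgraph n) (v : 'I_n) (s : seq nat) (u : 'I_n)
  : Prop :=
  exists vs, walk G v s = Some vs /\ uniq vs /\ last v vs = u.

Definition elects n (G : pgraph n) (out : 'I_n -> seq nat) : Prop :=
  exists u, forall v, describes_path G v (out v) u.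

Definition log2 (x : R) : R := (ln x / ln 2)%R.

(* Main.v *)
(** Hang 2^M pieces, each carrying its own M-bit code, on a ring, in an order
    given by a permutation s of Z/2^M.  A piece consists of a hub and an
    "antihub" both joined to M degree-two children, the j-th code bit being the
    port by which child j leaves towards the hub, and of a tail of phi - 1 edges
    from the hub to the border node lying on the ring.  The hub reads the code at
    depth 1, hence the border reads it at depth exactly phi: the election index
    is phi, and no node sees within depth phi which pieces neighbour its own.
    So a node of piece i outputs the same port sequence in two graphs with the
    same advice; it travels by the same displacement along both rings, and since
    all these paths end at one leader, the two orders differ by a rotation.
    Fixing the position of piece 0, the (2^M - 1)! orders need distinct advice
    strings, of length Omega(M 2^M) = Omega(n), which exceeds the bound. *)
Require Import Defs.
From mathcomp Require Import all_boot all_fingroup all_algebra.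
From mathcomp Require Import zify.
From Stdlib Require List.
Set Implicit Arguments. Unset Strict Implicit. Unset Printing Implicit Defensive.
Import GRing.Theory.


(** * Graphs given by a port function on a finite type *)

Section Ports.
Variables (T : finType) (d : T -> nat) (nb : T -> nat -> T * nat).

Definition mkgraph : pgraph #|T| :=
  PGraph (fun v => mkseq (fun p => (enum_rank (nb (enum_val v) p).1,
                                    (nb (enum_val v) p).2))
                         (d (enum_val v))).

Fixpoint tview (l : nat) (v : T) : view :=
  if l is l'.+1 then
    VNode [seq (p, (nb v p).2, tview l' (nb v p).1) | p <- iota 0 (d v)]
  else VLeaf (d v).

Lemma deg_mkgraph v : deg mkgraph v = d (enum_val v).
Proof. by rewrite /deg size_mkseq. Qed.

Lemma nbr_mkgraph v p : p < d (enum_val v) ->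
  nbr mkgraph v p = (enum_rank (nb (enum_val v) p).1, (nb (enum_val v) p).2).
Proof. by move=> lt_p; rewrite /nbr nth_mkseq. Qed.

Lemma bview_mkgraph l v : bview mkgraph l v = tview l (enum_val v).
Proof.
elim: l v => [|l IHl] v /=; rewrite deg_mkgraph //.
congr VNode; apply/eq_in_map => p; rewrite mem_iota => lt_p.
by rewrite nbr_mkgraph //= IHl enum_rankK.
Qed.

Lemma mem_adj_mkgraph v p : p < d v ->
  enum_rank (nb v p).1 \in [seq i.1 | i <- adj mkgraph (enum_rank v)].
Proof.
move=> lt_p; rewrite /= -map_comp enum_rankK.
by apply/mapP; exists p; rewrite ?mem_iota.
Qed.

Lemma adj_mkgraphP v w :
  w \in [seq i.1 | i <- adj mkgraph v] ->
  exists2 p, p < d (enum_val v) & enum_val w = (nb (enum_val v) p).1.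
Proof.
rewrite /= -map_comp => /mapP[p]; rewrite mem_iota add0n => lt_p ->.
by exists p; rewrite //= enum_rankK.
Qed.

(** The last hypothesis is connectivity as an induction principle towards [r]. Since edges are
    reversible, a walk from every node to [r] is enough. *)
Lemma valid_mkgraph (r : T) :
  (forall v p, p < d v -> [/\ (nb v p).1 != v, (nb v p).2 < d (nb v p).1
                            & nb (nb v p).1 (nb v p).2 = (v, p)]) ->
  (forall v, {in gtn (d v) &, injective (fun p => (nb v p).1)}) ->
  (forall S : T -> Prop, S r ->
     (forall v p, p < d v -> S (nb v p).1 -> S v) -> forall v, S v) ->
  valid_graph mkgraph.
Proof.
move=> nbK nb_inj to_root; split; [|split].
- move=> v p; rewrite deg_mkgraph => lt_p; rewrite nbr_mkgraph //=.
  have [neq lt_q eq_vp] := nbK _ _ lt_p.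
  rewrite deg_mkgraph nbr_mkgraph enum_rankK // eq_vp enum_valK; split=> //.
  by apply: contraNneq neq => {2}<-; rewrite enum_rankK.
- move=> v; rewrite /= -map_comp; apply/mkseq_uniqP => p q lt_p lt_q /=.
  by move=> /enum_rank_inj /(nb_inj _ _ _ lt_p lt_q).
pose e := [rel x y | y \in [seq i.1 | i <- adj mkgraph x]].
have sub_sym x y : e x y -> e y x.
  move=> /adj_mkgraphP[p lt_p eq_y].
  have [_ lt_q eq_vp] := nbK _ _ lt_p.
  by have := mem_adj_mkgraph lt_q; rewrite eq_vp -eq_y /= !enum_valK.
have e_sym : symmetric e by move=> x y; apply/idP/idP; apply: sub_sym.
have to_r v : connect e v (enum_rank r).
  rewrite -[v]enum_valK.
  apply: (to_root (fun v => connect e (enum_rank v) (enum_rank r))) => //.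
  by move=> u p lt_p; apply/connect_trans/connect1/mem_adj_mkgraph.
move=> v w; apply: connect_trans (to_r v) _.
by rewrite (sym_connect_sym e_sym) to_r.
Qed.
End Ports.

(** * Views and walks compared across two port functions *)

Section Compare.
Variables (T : finType) (d : T -> nat) (nb nb' : T -> nat -> T * nat).

Lemma tview_eqS l v w :
  tview d nb l.+1 v = tview d nb' l.+1 w ->
  d v = d w /\ forall p, p < d v ->
    (nb v p).2 = (nb' w p).2 /\
    tview d nb l (nb v p).1 = tview d nb' l (nb' w p).1.
Proof.
move=> [eq_s]; have eq_d : d v = d w.
  by have := congr1 size eq_s; rewrite !size_map !size_iota.
split=> // p lt_p; have := congr1 (nth (0, 0, VLeaf 0) ^~ p) eq_s.
by rewrite !(nth_map 0) ?size_iota -?eq_d // nth_iota // => -[].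
Qed.

Lemma eq_tviewS l v w :
  d v = d w -> (forall p, p < d v ->
    (nb v p).2 = (nb' w p).2 /\
    tview d nb l (nb v p).1 = tview d nb' l (nb' w p).1) ->
  tview d nb l.+1 v = tview d nb' l.+1 w.
Proof.
move=> eq_d eq_p; rewrite /= -eq_d; congr VNode; apply/eq_in_map => p.
by rewrite mem_iota add0n => /eq_p[-> ->].
Qed.

Lemma tview_eq_le l l' v w : l <= l' ->
  tview d nb l' v = tview d nb' l' w -> tview d nb l v = tview d nb' l w.
Proof.
elim: l l' v w => [|l IHl] [|l'] v w //= le_l /tview_eqS[eq_d eq_p].
  by rewrite eq_d.
by apply: eq_tviewS => // p /eq_p[-> /IHl->].
Qed.

Lemma tview_eq_deg l v w : tview d nb l v = tview d nb' l w -> d v = d w.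
Proof. by move=> /(tview_eq_le (leq0n l))[]. Qed.

(** The same port sequence is followed in both graphs, so only steps with equal local and equal
    remote ports have to preserve [S]. *)
Lemma walk_simulation (S : T -> T -> Prop) :
  (forall v w p, S v w -> p < d v -> p < d w ->
     (nb v p).2 = (nb' w p).2 -> S (nb v p).1 (nb' w p).1) ->
  forall s v w vs ws, S (enum_val v) (enum_val w) ->
    walk (mkgraph d nb) v s = Some vs -> walk (mkgraph d nb') w s = Some ws ->
    S (enum_val (last v vs)) (enum_val (last w ws)).
Proof.
move=> step s; have [n] := ubnP (size s).
elim: n s => // n IHn [|p [|q s]] //= lt_s v w vs ws Svw.
  by move=> [<-] [<-].
rewrite !deg_mkgraph; case: andP => [[lt_p]|//].
rewrite nbr_mkgraph //= => /eqP eq_q.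
case Ew: (walk _ _ s) => [vs1|//] [<-].
case: andP => [[lt_p']|//]; rewrite nbr_mkgraph //= => /eqP eq_q'.
case Ew': (walk _ _ s) => [ws1|//] [<-] /=.
(* A successful walk contains at least its start, so the default of [last] is irrelevant. *)
have walk_last G u us x : walk (n := #|T|) G u s = Some us -> last u us = last x us.
  case: s {lt_s Ew Ew'} => [|a [|b s]] //=; first by move=> [<-].
  by case: ifP => // _; case: walk => //= ? [<-].
rewrite -(walk_last _ _ _ v Ew) -(walk_last _ _ _ w Ew').
apply: IHn Ew Ew'; first by lia.
by rewrite !enum_rankK; apply: step => //; rewrite eq_q eq_q'.
Qed.
End Compare.

Arguments tview : simpl never.

(** * The ring of pieces is a valid graph *)

Section Necklace.
Variables (k h m : nat).

(* [tail 0] is the hub, [tail h.+1] the border (phi = h.+2), [anti] the antihub. *)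
Definition bead : finType := ('I_h.+2 + option 'I_m.+1)%type.
Definition node : finType := ('I_k.+3 * bead)%type.

Definition tail (t : nat) : bead := inl (inord t).
Definition anti : bead := inr None.
Definition child (j : nat) : bead := inr (Some (inord j)).

Variable code : 'I_k.+3 -> 'I_m.+1 -> bool.

Definition ndeg (v : node) : nat :=
  match v.2 with
  | inl t => if val t == 0 then m.+2 else if val t == h.+1 then 3 else 2
  | inr None => m.+1
  | inr (Some _) => 2
  end.

(* Port 0 of a tail node leads away from the hub, at the border to the next piece
   on the ring; port 1 leads to the hub, port 2 of the border to the previous
   piece.  Values at [p >= ndeg v] are junk. *)
Definition nport (s : {perm 'I_k.+3}) (v : node) (p : nat) : node * nat :=
  let i := v.1 in
  match v.2 with
  | inl t =>
      if p == 0 then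
        if val t == h.+1 then ((s^-1%g (s i + 1)%R, tail h.+1), 2)
        else ((i, tail t.+1), 1)
      else if val t == 0 then ((i, child p.-1), nat_of_bool (code i (inord p.-1)))
      else if p == 1 then ((i, tail t.-1), 0)
      else ((s^-1%g (s i - 1)%R, tail h.+1), 0)
  | inr None => ((i, child p), nat_of_bool (~~ code i (inord p)))
  | inr (Some j) =>
      if p == code i j then ((i, tail 0), j.+1) else ((i, anti), val j)
  end.

Notation nview s := (tview ndeg (nport s)).
Notation ngraph s := (mkgraph ndeg (nport s)).

Lemma ndeg_tail i t : t < h.+2 ->
  ndeg (i, tail t) = if t == 0 then m.+2 else if t == h.+1 then 3 else 2.
Proof. by move=> lt_t; rewrite /ndeg /= inordK. Qed.

Variant bead_spec : bead -> Type :=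
  | BeadTail t of t < h.+2 : bead_spec (tail t)
  | BeadAnti : bead_spec anti
  | BeadChild j of j < m.+1 : bead_spec (child j).

Lemma beadP x : bead_spec x.
Proof.
case: x => [t|[j|]]; last exact: BeadAnti.
  by rewrite -[t]inord_val; apply: BeadTail.
by rewrite -[j]inord_val; apply: BeadChild.
Qed.

Lemma nport_tail s i t p : t < h.+2 -> nport s (i, tail t) p =
  if p == 0 then
    if t == h.+1 then ((s^-1%g (s i + 1)%R, tail h.+1), 2)
    else ((i, tail t.+1), 1)
  else if t == 0 then ((i, child p.-1), nat_of_bool (code i (inord p.-1)))
  else if p == 1 then ((i, tail t.-1), 0)
  else ((s^-1%g (s i - 1)%R, tail h.+1), 0).
Proof. by move=> lt_t; rewrite /nport /= inordK. Qed.

Lemma nport_child s i j p : j < m.+1 -> nport s (i, child j) p =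
  if p == code i (inord j) then ((i, tail 0), j.+1) else ((i, anti), j).
Proof. by move=> lt_j; rewrite /nport /= inordK. Qed.

Lemma tail_inj t t' : t < h.+2 -> t' < h.+2 -> tail t = tail t' -> t = t'.
Proof. by move=> lt_t lt_t' [/(congr1 val)] /=; rewrite !inordK. Qed.

Lemma child_inj j j' : j < m.+1 -> j' < m.+1 -> child j = child j' -> j = j'.
Proof. by move=> lt_j lt_j' [/(congr1 val)] /=; rewrite !inordK. Qed.

Lemma eq_tail t t' : t < h.+2 -> t' < h.+2 -> (tail t == tail t') = (t == t').
Proof. by move=> lt_t lt_t'; apply/eqP/eqP => [/tail_inj->|->]. Qed.

Lemma perm_shift_neq (s : {perm 'I_k.+3}) i (z : 'I_k.+3) :
  (z != 0)%R -> s^-1%g (s i + z)%R != i.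
Proof.
apply: contraNneq => /(congr1 s); rewrite permKV => /eqP.
by rewrite -subr_eq0 addrC addKr.
Qed.

Lemma nportK s v p : p < ndeg v ->
  [/\ (nport s v p).1 != v, (nport s v p).2 < ndeg (nport s v p).1
    & nport s (nport s v p).1 (nport s v p).2 = (v, p)].
Proof.
case: v => i x; case/beadP: x => [t lt_t||j lt_j].
- rewrite ndeg_tail // nport_tail //; case: (eqVneq p 0) => [-> _|p0].
    case: (eqVneq t h.+1) => [->|th] /=.
      rewrite ndeg_tail // nport_tail //= permKV addrK permK xpair_eqE.
      by rewrite negb_and perm_shift_neq // !eqxx.
    have lt_t1 : t.+1 < h.+2 by lia.
    rewrite ndeg_tail // nport_tail //= xpair_eqE eqxx eq_tail //=.
    by split=> //; [lia | case: ifP].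
  case: (eqVneq t 0) => [->|t0] lt_p /=.
    have lt_p1 : p.-1 < m.+1 by lia.
    rewrite nport_child // eqxx xpair_eqE eqxx /=; split=> //.
      by rewrite /ndeg /=; case: code.
    by congr (_, _); lia.
  case: (eqVneq p 1) => [->|p1] /=.
    have lt_t1 : t.-1 < h.+2 by lia.
    rewrite ndeg_tail // nport_tail //= xpair_eqE eqxx eq_tail //=.
    split; first lia; first by case: ifP => //; case: ifP.
    have -> : t.-1 == h.+1 = false by lia.
    by rewrite prednK ?lt0n.
  have th : t = h.+1 by move: lt_p; case: eqVneq => //; lia.
  have {p0 p1}-> : p = 2 by move: lt_p; case: ifP; lia.
  rewrite {t lt_t t0 lt_p}th ndeg_tail // nport_tail //= eqxx permKV subrK permK.
  by rewrite xpair_eqE negb_and perm_shift_neq ?oppr_eq0.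
- rewrite {1}/ndeg /= => lt_p; rewrite /ndeg /= nport_child // xpair_eqE eqxx.
  by case: code.
rewrite {1}/ndeg /= => lt_p; rewrite nport_child //.
case: (p =P _) => [->|ne] /=.
  by rewrite ndeg_tail // nport_tail //= xpair_eqE eqxx.
rewrite /ndeg /= /nport /= xpair_eqE eqxx; split=> //.
congr (_, _); move: ne lt_p; case: code; lia.
Qed.

Lemma nport_inj s v : {in gtn (ndeg v) &, injective (fun p => (nport s v p).1)}.
Proof.
case: v => i x; case/beadP: x => [t lt_t||j lt_j] p q; rewrite !unfold_in /=.
- rewrite ndeg_tail // !nport_tail //.
  case: (eqVneq t 0) => [->|t0] lt_p lt_q.
    by case: (eqVneq p 0) => [->|p0];
      case: (eqVneq q 0) => [->|q0] /(congr1 snd) //= /child_inj; lia.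
  (* The two ring neighbours differ because 2 is nonzero modulo [k.+3]: there is no double edge. *)
  have ne_shift : s^-1%g (s i + 1)%R <> s^-1%g (s i - 1)%R.
    move=> /perm_inj /addrI /eqP; rewrite -addr_eq0 => /eqP /(congr1 val) /=.
    by rewrite !modn_small.
  case: (eqVneq t h.+1) lt_p lt_q => [->|th]; last first.
    by case: p q => [|[|p]] [|[|q]] //= _ _ /(congr1 snd) /tail_inj; lia.
  have ne_tail : tail h <> tail h.+1 by move=> /tail_inj; lia.
  by case: p q => [|[|[|p]]] [|[|[|q]]] //= _ _ /eqP;
    rewrite xpair_eqE => /andP[/eqP e1 /eqP e2]; congruence.
- by rewrite /ndeg /= => lt_p lt_q /(congr1 snd) /child_inj; apply.
rewrite !nport_child // /ndeg /= => lt_p lt_q.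
by case: (p =P _) => [->|ne_p]; case: (q =P _) => [->|ne_q] //= _;
  move: ne_p ne_q; case: code; lia.
Qed.

(** Antihub to child, child to hub, along the tail to the border, then backwards round the ring to
    position 0. *)
Lemma nconnect (s : {perm 'I_k.+3}) (S : node -> Prop) :
  S (s^-1%g 0%R, tail h.+1) ->
  (forall v p, p < ndeg v -> S (nport s v p).1 -> S v) -> forall v, S v.
Proof.
move=> S0 Sstep.
have S_border n : S (s^-1%g n%:R%R, tail h.+1).
  elim: n => // n IHn; apply: (Sstep _ 2); first by rewrite ndeg_tail // eqxx.
  by rewrite nport_tail //= permKV -natr1 addrK.
have S_tail i t : t < h.+2 -> S (i, tail t).
  move=> lt_t; have [n le_n] := ubnP (h.+1 - t).
  elim: n t lt_t le_n => // n IHn t lt_t le_n.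
  have [->|th] := eqVneq t h.+1.
    by have := S_border (s i); rewrite natr_Zp permK.
  apply: (Sstep _ 0); first by rewrite ndeg_tail //; case: ifP => // _; case: ifP.
  by rewrite nport_tail //= (negPf th); apply: IHn; lia.
have S_child i j : j < m.+1 -> S (i, child j).
  move=> lt_j; apply: (Sstep _ (code i (inord j))).
    by rewrite /ndeg /=; case: code.
  by rewrite nport_child // eqxx; apply: S_tail.
case=> i x; case/beadP: x => [t||j]; [exact: S_tail | | exact: S_child].
by apply: (Sstep _ 0) => //; apply: S_child.
Qed.

Lemma valid_ngraph s : valid_graph (ngraph s).
Proof. exact: valid_mkgraph (@nportK s) (@nport_inj s) (@nconnect s). Qed.

(** * What views reveal: the election index, and blindness to the ring order *)

Hypothesis le3m : 3 <= m.
Hypothesis code_inj : forall i i', code i =1 code i' -> i = i'.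

Lemma core_view_inj s l i i' :
  nview s l.+1 (i, tail 0) = nview s l.+1 (i', tail 0) -> i = i'.
Proof.
move=> /tview_eqS[_ eq_p]; apply: code_inj => j.
have /eq_p[] : j.+1 < ndeg (i, tail 0) by rewrite ndeg_tail //= ltnS.
by rewrite !nport_tail //= inord_val; do 2!case: code.
Qed.

(** Port 1 leads down the tail; after [t] steps the hub is reached with at least one level left,
    enough to read the code. *)
Lemma tail_view_inj s l i i' t t' : t < l -> t < h.+2 -> t' < h.+2 ->
  nview s l (i, tail t) = nview s l (i', tail t') -> i = i' /\ t = t'.
Proof.
elim: t l t' => [|t IHt] [|l] // t' lt_tl lt_t lt_t' eq_v.
  have := tview_eq_deg eq_v; rewrite !ndeg_tail //=.
  case: (eqVneq t' 0) eq_v => [->|_] eq_v; last by case: ifP; lia.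
  by move=> _; rewrite (core_view_inj eq_v).
have := tview_eq_deg eq_v; rewrite !ndeg_tail //=.
case: t' lt_t' eq_v => [|t'] lt_t' eq_v /=; first by case: ifP; lia.
move=> _; have [_ /(_ 1)[]] := tview_eqS eq_v.
  by rewrite ndeg_tail //=; case: ifP.
rewrite !nport_tail //= => _ /IHt[]//; first exact: ltnW.
  exact: ltnW.
by move=> -> ->.
Qed.

Lemma anti_view_inj s l i i' :
  nview s l.+1 (i, anti) = nview s l.+1 (i', anti) -> i = i'.
Proof.
move=> /tview_eqS[_ eq_p]; apply: code_inj => j.
have /eq_p[/=] : j < ndeg (i, anti) by [].
by rewrite inord_val; do 2!case: code.
Qed.

(** The port given by the code bit leads to the hub, recognised by its degree; the remote port there
    gives [j] and the hub's view gives [i]. *)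
Lemma child_view_inj s l i i' j j' : j < m.+1 -> j' < m.+1 ->
  nview s l.+2 (i, child j) = nview s l.+2 (i', child j') -> i = i' /\ j = j'.
Proof.
move=> lt_j lt_j' /tview_eqS[_ /(_ (code i (inord j)))[]].
  by rewrite /ndeg /=; case: code.
rewrite !nport_child // eqxx; case: eqP => _ /=.
  by move=> [->] /core_view_inj ->.
by move=> _ /tview_eq_deg; rewrite ndeg_tail // /ndeg /=; lia.
Qed.

(** Only an inner tail node shares the degree 2 of a child. Its port 0 leads to a node of degree 2
    or 3, whereas that of a child leads to a hub or antihub, of degree at least 4. *)
Lemma child_tail_view s l i i' j t : j < m.+1 -> t < h.+2 ->
  nview s l.+2 (i, child j) <> nview s l.+2 (i', tail t).
Proof.
move=> lt_j lt_t eq_v; have := tview_eq_deg eq_v.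
rewrite ndeg_tail // {1}/ndeg /=; case: eqP => [_|t0]; first by lia.
case: eqP => // th _; have [_ /(_ 0)[]] := tview_eqS eq_v; first by [].
rewrite nport_child // nport_tail //=; have -> : t == h.+1 = false by lia.
move=> _ /tview_eq_deg /=; rewrite [RHS]ndeg_tail /=; last by lia.
by case: ifP => _; rewrite /ndeg /=; [rewrite inordK //= | ]; case: ifP; lia.
Qed.

(** As [3 <= m], the degrees [m.+2], [m.+1] and 3 single out hub, antihub and border. *)
Lemma nview_inj s : injective (nview s h.+2).
Proof.
move=> [i x] [i' x']; case/beadP: x => [t lt_t||j lt_j];
  case/beadP: x' => [t' lt_t'||j' lt_j'] eq_v.
- by have [-> ->] := tail_view_inj lt_t lt_t lt_t' eq_v.
- have := tview_eq_deg eq_v; rewrite ndeg_tail // /ndeg /=.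
  by do 2?case: ifP; lia.
- by case: (child_tail_view lt_j' lt_t (esym eq_v)).
- have := tview_eq_deg eq_v; rewrite ndeg_tail // /ndeg /=.
  by do 2?case: ifP; lia.
- by rewrite (anti_view_inj eq_v).
- by have := tview_eq_deg eq_v; rewrite /ndeg /=; lia.
- by case: (child_tail_view lt_j lt_t' eq_v).
- by have := tview_eq_deg eq_v; rewrite /ndeg /=; lia.
by have [-> ->] := child_view_inj lt_j lt_j' eq_v.
Qed.

(* The code of a piece is written at distance [t] from [tail t], so it is
   invisible at depth [l <= t]. *)
Lemma tail_view_blind s s' l i i' t : l <= t -> t < h.+2 ->
  nview s l (i, tail t) = nview s' l (i', tail t).
Proof.
elim: l i i' t => [|l IHl] i i' t le_lt lt_t; first by rewrite /tview !ndeg_tail.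
apply: eq_tviewS => [|p lt_p]; first by rewrite !ndeg_tail.
rewrite !nport_tail //; have -> : t == 0 = false by lia.
case: ifP => _; last by case: ifP => _; split=> //=; apply: IHl; lia.
by case: ifP => th; split=> //=; apply: IHl; lia.
Qed.

(* Another piece is entered at its border, with depth at most [h.+1] left, so
   [tail_view_blind] applies there. *)
Lemma nview_perm s s' l v : l <= h.+2 -> nview s l v = nview s' l v.
Proof.
elim: l v => // l IHl [i x] lt_l; apply: eq_tviewS => // p lt_p.
case/beadP: x lt_p => [t lt_t||j lt_j] lt_p.
- rewrite !nport_tail //.
  do 3?case: ifP => _; split=> //=; try (by apply: IHl; lia);
    by apply: tail_view_blind.
- by split=> //; apply: IHl; lia.
by rewrite !nport_child //; case: ifP => _; split=> //=; apply: IHl; lia.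
Qed.

Lemma election_index_ngraph s : election_index (ngraph s) h.+2.
Proof.
split=> [v w|l lt_l inj_l].
  by rewrite !bview_mkgraph => /nview_inj /enum_val_inj.
(* Two borders are indistinguishable at every depth below [h.+2]. *)
pose v (i : 'I_k.+3) : node := (i, tail h.+1).
suff /inj_l /enum_rank_inj[] : bview (ngraph s) l (enum_rank (v 0%R)) =
    bview (ngraph s) l (enum_rank (v 1%R)) by rewrite modn_small.
by rewrite !bview_mkgraph !enum_rankK; apply: tail_view_blind.
Qed.

(** * Equal advice forces equal ring orders *)

Definition shifted (s s' : {perm 'I_k.+3}) c (v w : node) : Prop :=
  v.2 = w.2 /\ s' w.1 = (s v.1 + c)%R.

(* At a child, equal remote ports [j.+1] (hub) or [j] (antihub) force both walks
   to the same kind of node although the local ports depend on the code. *)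
Lemma shifted_step s s' c v w p : shifted s s' c v w ->
  p < ndeg v -> p < ndeg w -> (nport s v p).2 = (nport s' w p).2 ->
  shifted s s' c (nport s v p).1 (nport s' w p).1.
Proof.
case: v w => [i x] [i' _] [/= <- sh]; case/beadP: x => [t lt_t||j lt_j] lt_p _.
- rewrite !nport_tail //; do 3?case: ifP => _; split=> //=;
  by rewrite !permKV sh addrAC.
- by split.
rewrite !nport_child //.
by do 2!case: ifP => _ /=; first [by split | lia].
Qed.

Lemma ngraph_fooling s s' (out : view -> seq nat) :
  elects (ngraph s) (fun v => out (bview (ngraph s) h.+2 v)) ->
  elects (ngraph s') (fun v => out (bview (ngraph s') h.+2 v)) ->
  s 0%R = s' 0%R -> s = s'.
Proof.
move=> [u el] [u' el'] eq0.
(* Here [s i] is the ring position of piece [i]. Its border outputs the same ports in both graphs,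
   so the initial displacement [s' i - s i] survives up to the leaders [u] and [u'], which do not
   depend on [i]. *)
have eq_shift i : (s' i - s i = s' (enum_val u').1 - s (enum_val u).1)%R.
  have [vs [walk_v [_ last_v]]] := el (enum_rank (i, tail h.+1)).
  have [ws [walk_w [_ last_w]]] := el' (enum_rank (i, tail h.+1)).
  move: walk_v walk_w; rewrite !bview_mkgraph (nview_perm s s') // => walk_v walk_w.
  pose b := enum_rank ((i, tail h.+1) : node).
  have sh : shifted s s' (s' i - s i)%R (enum_val b) (enum_val b).
    by split=> //; rewrite enum_rankK addrC subrK.
  have [_] := walk_simulation (@shifted_step s s' _) sh walk_v walk_w.
  by rewrite last_v last_w => ->; rewrite addrAC subrr add0r.
apply/permP => i; apply/eqP; rewrite eq_sym -subr_eq0 eq_shift.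
by rewrite -(eq_shift 0%R) eq0 subrr.
Qed.

End Necklace.

(** * Counting ring orders against advice strings *)

Lemma leq_exp_fact a b : 0 < a -> a ^ b <= (a + b).-1`!.
Proof.
move=> a_gt0; elim: b => [|b IHb]; first by rewrite fact_gt0.
rewrite expnS addnS -[X in _ <= X`!](prednK (ltn_addr b a_gt0)) factS.
by rewrite prednK ?ltn_addr // leq_mul // leq_addr.
Qed.

Lemma many_strings_long (X : finType) (D : pred X) (f : X -> seq bool) B :
  {in D &, injective f} -> B * 2 ^ B < #|D| ->
  exists2 x, x \in D & B <= size (f x).
Proof.
move=> f_inj; case: B => [|B] lt_D.
  by have /card_gt0P[x Dx] := leq_ltn_trans (leq0n _) lt_D; exists x.
apply/exists_inP; apply: contraTT lt_D; rewrite negb_exists_in -leqNgt.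
move=> /forall_inP long; have {long}short x : x \in D -> size (f x) < B.+1.
  by move=> /long; rewrite -ltnNge.
(* A string of length at most [B] is determined by its length and its padding with [false] to [B.+1]
   bits. *)
pose g x : 'I_B.+1 * B.+1.-tuple bool :=
  (inord (size (f x)), [tuple nth false (f x) i | i < B.+1]).
have g_inj : {in D &, injective g}.
  move=> x y Dx Dy eq_g; have := congr1 (val \o fst) eq_g.
  rewrite /= !inordK ?short // => eq_sz; apply: f_inj => //.
  apply: (eq_from_nth (x0 := false)) => // i lt_i.
  have lt_iB : i < B.+1 by apply: ltn_trans lt_i _; apply: short.
  by have := congr1 (fun u => tnth u.2 (Ordinal lt_iB)) eq_g;
    rewrite !tnth_mktuple.
rewrite -(card_in_imset g_inj); apply: leq_trans (max_card _) _.
by rewrite card_prod card_ord card_tuple card_bool.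
Qed.

Lemma In_mapP (X : eqType) Y (f : X -> Y) s y :
  List.In y (map f s) <-> exists2 x, x \in s & y = f x.
Proof.
elim: s => [|x s IHs] /=; first by split=> [|[]].
split=> [[<-|/IHs[z s_z ->]]|[z]].
- by exists x; rewrite ?mem_head.
- by exists z; rewrite // inE s_z orbT.
by rewrite inE => /predU1P[->|s_z] def_y; [left | right; apply/IHs; exists z].
Qed.

Lemma necklace_family h m : 3 <= m ->
  exists n, m <= n /\ exists F : seq (pgraph n),
    (forall G, List.In G F ->
       valid_graph G /\ feasible G /\ election_index G h.+2) /\
    forall (O : pgraph n -> seq bool) (A : seq bool -> view -> seq nat),
      (forall G, List.In G F ->
         elects G (fun v => A (O G) (bview G h.+2 v))) ->
      exists2 G, List.In G F & n <= 4 * (h + 3) * size (O G).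
Proof.
move=> le3m; pose k := 2 ^ m.+1 - 3.
have le8 : 2 ^ 3 <= 2 ^ m by rewrite leq_exp2l.
have def_k : k.+3 = 2 ^ m.+1 by rewrite /k expnS; lia.
have card_code : k.+3 = #|{: {ffun 'I_m.+1 -> bool}}|.
  by rewrite card_ffun card_bool card_ord.
pose code (i : 'I_k.+3) (j : 'I_m.+1) : bool :=
  (enum_val (cast_ord card_code i) : {ffun 'I_m.+1 -> bool}) j.
have code_inj i i' : code i =1 code i' -> i = i'.
  by move=> /ffunP /enum_val_inj /cast_ord_inj.
pose G (s : {perm 'I_k.+3}) := mkgraph (@ndeg k h m) (nport code s).
(* Fixing the position of piece 0 leaves one order from each class under rotation. *)
pose D := perm_on (T := 'I_k.+3) [set~ 0%R].
have card_node : #|node k h m| = 2 ^ m.+1 * (h + m + 4).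
  by rewrite card_prod card_sum card_option !card_ord def_k; congr (_ * _); lia.
have def_expm : 2 ^ m = 2 * 2 ^ m.-1 by rewrite -expnS prednK //; lia.
exists #|node k h m|; split; first by rewrite card_node expnS; nia.
exists [seq G s | s in D]; split=> [_ /In_mapP[s _ ->]|O A electsF].
  have idx : election_index (G s) h.+2 by exact: election_index_ngraph.
  by split; [exact: valid_ngraph | split=> //; exists h.+2; case: idx].
(* With [B] equal to [m * 2 ^ m.-1], [2 ^ B] is the square root of [(2 ^ m) ^ 2 ^ m]. *)
have [||s Ds le_s] := @many_strings_long _ D (O \o G) (m * 2 ^ m.-1).
- move=> s s' Ds Ds' /= eqO.
  have memF r : r \in D -> List.In (G r) [seq G s | s in D].
    by move=> Dr; apply/In_mapP; exists r; rewrite ?mem_enum.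
  have := electsF _ (memF s' Ds'); rewrite -eqO => el'.
  apply: (ngraph_fooling le3m (electsF _ (memF s Ds)) el').
  by rewrite !(out_perm (S := [set~ 0%R])) // !inE eqxx.
- rewrite card_perm cardsC1 card_ord def_k.
  have -> : 2 ^ m.+1 = 2 ^ m + 2 ^ m by rewrite expnS mul2n addnn.
  (* The top [2 ^ m] factors of the factorial of [2 ^ m.+1 - 1] are each at least [2 ^ m]. *)
  apply: leq_trans (leq_exp_fact _ _); last by rewrite expn_gt0.
  set B := m * _; have -> : (2 ^ m) ^ 2 ^ m = 2 ^ B * 2 ^ B.
    rewrite -expnM -expnD; congr (2 ^ _); rewrite /B -mulnDr; congr (_ * _).
    by rewrite def_expm mul2n addnn.
  by rewrite ltn_pmul2r ?expn_gt0 // ltn_expl.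
exists (G s); first by apply/In_mapP; exists s; rewrite ?mem_enum.
have le_arith : h + m + 4 <= (h + 3) * m by nia.
move: (size _) le_s => /= a le_a; rewrite card_node expnS def_expm.
rewrite mulnA -[4 * _ * _]mulnA -mulnA leq_pmul2l //.
apply: leq_trans (leq_mul (leqnn (h + 3)) le_a).
by rewrite mulnA [X in _ <= X]mulnC leq_mul2l le_arith orbT.
Qed.

(* Real estimates and the final bound *)
From mathcomp Require Import all_boot.
From Stdlib Require Import Reals Lra.

(** Weakens the linear bound of [necklace_family] to the claimed one. With [y] for [log2 x],
    [ln y = 2 ln (sqrt y) <= 2 sqrt y] and [ln 2 > 1/2] give [log2 y <= 4 sqrt y]. *)
Lemma loglog_sq_bound (x : R) :
  (2 <= x -> log2 (log2 x) ^ 2 / log2 x <= 16)%R.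
Proof.
move=> le2x; have ln2 := ln_lt_2.
have y1 : (1 <= log2 x)%R.
  rewrite /log2; apply: (Rmult_le_reg_r (ln 2)); first lra.
  rewrite /Rdiv Rmult_assoc Rinv_l ?Rmult_1_l ?Rmult_1_r; last lra.
  by case: le2x => [lt2x|<-]; [left; apply: ln_increasing; lra | right].
move: (log2 x) y1 => y y1; rewrite {1}/log2.
have sq := sqrt_sqrt y ltac:(lra); have sq0 := sqrt_lt_R0 y ltac:(lra).
have ln0 : (0 <= ln y)%R.
  case: y1 => [lt1y|<-]; [by rewrite -ln_1; left; apply: ln_increasing; lra |].
  by rewrite ln_1; lra.
have ln_sqrt : (ln y <= 2 * sqrt y)%R.
  rewrite -{1}sq ln_mult //.
  have := exp_ineq1_le (ln (sqrt y)); rewrite exp_ln //; lra.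
have le_quot : (0 <= ln y / ln 2 <= 4 * sqrt y)%R.
  split; first by apply: Rmult_le_pos => //; left; apply: Rinv_0_lt_compat; lra.
  apply: (Rmult_le_reg_r (ln 2)); first lra.
  rewrite /Rdiv Rmult_assoc Rinv_l; last lra.
  nra.
apply: (Rmult_le_reg_r y); first lra.
rewrite {1}/Rdiv Rmult_assoc Rinv_l; last lra.
nra.
Qed.

(* An algorithm with advice working in time phi: the output of node v is a
   function A of the advice and of B^phi(v); an oracle O maps each graph to
   an advice string. *)
Theorem theorem3 (phi : nat) (Hphi : 1 < phi) :
  exists c : R, (0 < c)%R /\
  forall N : nat, exists n : nat, N <= n /\
  exists F : seq (pgraph n),
    (forall G, List.In G F ->
       valid_graph G /\ feasible G /\ election_index G phi) /\
    forall (O : pgraph n -> seq bool) (A : seq bool -> view -> seq nat),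
      (forall G, List.In G F -> elects G (fun v => A (O G) (bview G phi v))) ->
      exists G, List.In G F /\
        (c * INR n * (log2 (log2 (INR n))) ^ 2 / log2 (INR n)
           <= INR (size (O G)))%R.
Proof.
case: phi Hphi => [|[|h]] // _.
pose K := INR (h + 3); have K0 : (0 < K)%R by apply: lt_0_INR; lia.
(* 64 is the 4 of [necklace_family] times the 16 of [loglog_sq_bound]. *)
exists (/ (64 * K))%R; split; first by apply: Rinv_0_lt_compat; lra.
move=> N; pose m := N + 3.
have [|n [le_mn [F [okF hardF]]]] := @necklace_family h m; first by lia.
have [Nn n2] : N <= n /\ 2 <= n by lia.
exists n; split=> //; exists F; split=> // O A electsF.
have [G FG le_G] := hardF O A electsF; exists G; split=> //.
have bound := @loglog_sq_bound (INR n) (le_INR 2 n ltac:(lia)).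
have le_nR : (INR n <= 4 * K * INR (size (O G)))%R.
  move: le_G => /leP /le_INR; rewrite -!multE !mult_INR -/K.
  by change (INR 4) with (1 + 1 + 1 + 1)%R; lra.
have n0 := pos_INR n.
apply: (Rmult_le_reg_l (64 * K)); first lra.
set L := (_ ^ 2)%R in bound *; set Q := (log2 (INR n)) in bound *.
have -> : (64 * K * (/ (64 * K) * INR n * L / Q) = INR n * (L / Q))%R.
  by rewrite /Rdiv -!Rmult_assoc Rinv_r ?Rmult_1_l //; lra.
nra.
Qed.
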